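(* (Burke's property.) Let $p\in(0,1)$ and $p<u\le1$. Let $I,J,\omega$ be independent random variables with $$I\sim\mathrm{Ber}(u),\qquad J\sim\mathrm{Geom}\Big(\frac{u-p}{u(1-p)}\Big),\qquad \omega\sim\mathrm{Ber}(p),$$ and define $$\tilde I=\max\{I-J,\omega\},\qquad \tilde J=(J-I+\omega)^+,\qquad \alpha=\min\{I,J+\omega\}.$$ Then $\tilde I,\tilde J,\alpha$ are mutually independent with the same marginal distributions, i.e. $$\tilde I\sim\mathrm{Ber}(u),\qquad \tilde J\sim\mathrm{Geom}\Big(\frac{u-p}{u(1-p)}\Big),\qquad \alpha\sim\mathrm{Ber}(p).$$
   Context: $\mathrm{Ber}(q)$ is the law on $\{0,1\}$ with mass $q$ at $1$. $\mathrm{Geom}(q)$ is the law on $\mathbb Z_+=\{0,1,2,\dots\}$ with mass $q(1-q)^\ell$ at $\ell$; for $q=\frac{u-p}{u(1-p)}$ one has $1-q=\frac{p(1-u)}{u(1-p)}$. $x^+=\max\{x,0\}$. *)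

(* Defs.v *)
From HB Require Import structures.
From mathcomp Require Import all_boot all_order all_algebra.
From mathcomp Require Import all_classical all_reals all_analysis.
From mathcomp Require Import measurable_realfun.

Set Implicit Arguments.
Unset Strict Implicit.
Unset Printing Implicit Defensive.

Import Order.TTheory GRing.Theory Num.Theory.
Import numFieldNormedType.Exports.

Local Open Scope classical_set_scope.
Local Open Scope ring_scope.

(* Random variables are real-valued, so that differences, [Num.max] and
   [Num.min] are the usual ones; Ber(q) and Geom(q) are accordingly transported
   to the Borel sets of R along the injections of bool and nat into R. *)

Definition Ber (R : realType) (q : R) : set R -> \bar R :=
  pushforward (bernoulli_prob q) (fun b : bool => b%:R : R).

(* Support {0, 1, 2, ...} (number of failures).  Since 0 ^+ 0 = 1, the case
   q = 1 is the point mass at 0. *)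
Definition geometric_pmf (R : realType) (q : R) (l : nat) : R :=
  q * (1 - q) ^+ l.

Definition geometric_prob (R : realType) (q : R) : set nat -> \bar R :=
  fun A => (\esum_(l in A) (geometric_pmf q l)%:E)%E.

Definition Geom (R : realType) (q : R) : set R -> \bar R :=
  pushforward (geometric_prob q) (fun l : nat => l%:R : R).

Section RandomVariables.
Context (d : measure_display) (T : measurableType d) (R : realType).
Context (P : probability T R).

Definition has_law (X : {RV P >-> R}) (mu : set R -> \bar R) : Prop :=
  forall A : set R, measurable A -> distribution P X A = mu A.

Definition mutually_independent (K : finType) (X : K -> {RV P >-> R}) : Prop :=
  forall (S : {set K}) (A : K -> set R), (forall i, measurable (A i)) ->
    P (\bigcap_(i in [set` S]) (X i @^-1` A i)) =
    (\prod_(i in S) P (X i @^-1` A i))%E.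

Implicit Types I J omega : {RV P >-> R}.

Definition burke_I_fun I J omega (x : T) : R :=
  Num.max (I x - J x) (omega x).

Definition burke_J_fun I J omega (x : T) : R :=
  Num.max (J x - I x + omega x) 0.

Definition burke_alpha_fun I J omega (x : T) : R :=
  Num.min (I x) (J x + omega x).

Lemma measurable_burke_I I J omega :
  measurable_fun setT (burke_I_fun I J omega).
Proof. by apply: measurable_maxr => //; exact: measurable_funB. Qed.

Lemma measurable_burke_J I J omega :
  measurable_fun setT (burke_J_fun I J omega).
Proof.
by apply: measurable_maxr => //; apply: measurable_funD => //;
  exact: measurable_funB.
Qed.

Lemma measurable_burke_alpha I J omega :
  measurable_fun setT (burke_alpha_fun I J omega).
Proof. by apply: measurable_minr => //; exact: measurable_funD. Qed.

HB.instance Definition _ I J omega :=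
  isMeasurableFun.Build _ _ _ _ _ (measurable_burke_I I J omega).
HB.instance Definition _ I J omega :=
  isMeasurableFun.Build _ _ _ _ _ (measurable_burke_J I J omega).
HB.instance Definition _ I J omega :=
  isMeasurableFun.Build _ _ _ _ _ (measurable_burke_alpha I J omega).

Definition burke_I I J omega : {RV P >-> R} :=
  burke_I_fun I J omega : {mfun T >-> R}.
Definition burke_J I J omega : {RV P >-> R} :=
  burke_J_fun I J omega : {mfun T >-> R}.
Definition burke_alpha I J omega : {RV P >-> R} :=
  burke_alpha_fun I J omega : {mfun T >-> R}.

End RandomVariables.

(* Main.v *)
Require Import Defs.
From HB Require Import structures.
From mathcomp Require Import all_boot all_order all_algebra.
From mathcomp Require Import all_classical all_reals all_analysis.
From mathcomp Require Import measurable_realfun.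
From mathcomp Require Import ring lra.

Set Implicit Arguments.
Unset Strict Implicit.
Unset Printing Implicit Defensive.

Import Order.TTheory GRing.Theory Num.Theory.
Import numFieldNormedType.Exports.

Local Open Scope classical_set_scope.
Local Open Scope ring_scope.

(** On the values that [I], [J], [omega] take, the map sending the triple
    [(I, J, omega)] to its transform is an involution of the state space
    {0,1} x nat x {0,1}: it exchanges (0, l, 1) with (1, l+1, 0) and fixes every
    other state.  The product weight Ber(u) x Geom(q) x Ber(p) is invariant
    under this exchange, because
      (1-u) q (1-q)^l p = u q (1-q)^(l+1) (1-p),
    which is the formula 1 - q = p (1-u) / (u (1-p)).  A permutation of a
    countable state space that preserves the weights preserves the law, so the
    transformed triple has the same joint law as [(I, J, omega)]
    ([burke_same_joint_law]).  Independence and the three marginals are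
    properties of the joint law, hence are inherited.

    The involution argument is [probability_discrete_symmetry]; it rests on the
    expansion of a probability over the atoms of a discrete random element
    ([probability_discrete]).  The two computations specific to this problem
    are [burke_map_embed] and [burke_weight_step]. *)

(** * Discrete random elements *)

Section DiscreteElements.
Context (d : measure_display) (T : measurableType d) (R : realType).
Context (P : probability T R).

(** The mass of [range f] is obtained from that of [setT], which has the same
    preimage under [f]; in particular no geometric series has to be summed. *)
Lemma has_law_range (d' : measure_display) (U : measurableType d')
    (X : {RV P >-> R}) (nu : set U -> \bar R) (f : U -> R) :
  measurable (range f) -> has_law X (pushforward nu f) ->
  P (X @^-1` range f) = 1%E.
Proof.
move=> mf hX; rewrite -[LHS]/(distribution P X _) hX //.
have -> : pushforward nu f (range f) = pushforward nu f setT.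
  by congr (nu _); apply/seteqP; split=> // x _; exists x.
by rewrite -hX // probability_setT.
Qed.

Lemma probability_bigcup_countType (S : countType) (B : set S)
    (F : S -> set T) :
  (forall s, measurable (F s)) -> trivIset setT F ->
  P (\bigcup_(s in B) F s) = (\esum_(s in B) P (F s))%E.
Proof.
move=> mF tF.
(* Enumerate S by its codes; additivity over nat then gives the claim. *)
pose G n := if unpickle n is Some s then F s else set0.
have GE s : G (pickle s) = F s by rewrite /G pickleK.
have -> : \bigcup_(s in B) F s = \bigcup_(n in pickle @` B) G n.
  by rewrite bigcup_image; apply: eq_bigcupr => s _; rewrite GE.
rewrite measure_bigcup.
- rewrite nneseries_esum // set_mem_set (@reindex_esum _ _ _ B _ pickle).
    by apply: eq_esum => s _; rewrite GE.
  split=> [s Bs|s t _ _ /(pcan_inj pickleK) //|n [s Bs <-]]; first by exists s.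
  by exists s.
- by move=> n _; rewrite /G; case: unpickle.
- move=> _ _ [s _ <-] [t _ <-]; rewrite !GE => st.
  by congr pickle; exact: tF.
Qed.

(** An element that almost surely takes the countably many values [v s] has its
    law determined by the masses of these values. *)
Lemma probability_discrete (S : countType) (U : Type) (Z : T -> U)
    (v : S -> U) (C : set U) :
  injective v -> (forall s, measurable (Z @^-1` [set v s])) ->
  P (Z @^-1` range v) = 1%E -> measurable (Z @^-1` C) ->
  P (Z @^-1` C) = (\esum_(s in v @^-1` C) P (Z @^-1` [set v s]))%E.
Proof.
move=> vI mv v1 mC.
have mW : measurable (Z @^-1` range v).
  have -> : Z @^-1` range v = \bigcup_s Z @^-1` [set v s].
    by apply/seteqP; split=> x [s _ /= vs]; exists s.
  exact: countable_bigcupT_measurable.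
have WC0 : P (~` (Z @^-1` range v)) = 0%E.
  by rewrite probability_setC // v1 subee.
have PC0 : P (Z @^-1` C `\` Z @^-1` range v) = 0%E.
  apply: (@subset_measure0 _ _ _ P _ (~` (Z @^-1` range v))).
  - exact: measurableD.
  - exact: measurableC.
  - exact: subDsetr.
  - exact: WC0.
have -> : P (Z @^-1` C) = P (Z @^-1` C `&` Z @^-1` range v).
  by rewrite -[RHS]add0e -PC0; exact: measureDI.
have -> : Z @^-1` C `&` Z @^-1` range v =
          \bigcup_(s in v @^-1` C) Z @^-1` [set v s].
  apply/seteqP; split=> [x [Cx [s _ vs]]|x [s Cs /= Zx]].
    by exists s => //=; rewrite vs.
  by split; [rewrite /= Zx|exists s].
apply: probability_bigcup_countType => // s t _ _ [x [/= -> /vI]].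
exact.
Qed.

(** If [b] acts on the values as a weight-preserving involution [phi] of their
    indices, then [b] preserves the law: reindex the sum over atoms by [phi]. *)
Lemma probability_discrete_symmetry (S : countType) (U : Type) (Z : T -> U)
    (v : S -> U) (b : U -> U) (phi : S -> S) (C : set U) :
  injective v -> (forall s, measurable (Z @^-1` [set v s])) ->
  P (Z @^-1` range v) = 1%E ->
  involutive phi -> (forall s, b (v s) = v (phi s)) ->
  (forall s, P (Z @^-1` [set v (phi s)]) = P (Z @^-1` [set v s])) ->
  measurable (Z @^-1` C) -> measurable ((b \o Z) @^-1` C) ->
  P ((b \o Z) @^-1` C) = P (Z @^-1` C).
Proof.
move=> vI mv v1 phiK bv Pphi mC mbC; rewrite comp_preimage in mbC *.
rewrite (@probability_discrete _ _ Z v (b @^-1` C)) //.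
rewrite (@probability_discrete _ _ Z v C) //.
rewrite (@reindex_esum _ _ _ (v @^-1` (b @^-1` C)) (v @^-1` C) phi).
  by apply: eq_esum => s _; rewrite Pphi.
split=> [s /=|s t _ _|s /= Cs].
- by rewrite bv.
- exact: (can_inj phiK).
- by exists (phi s); rewrite /= ?bv phiK.
Qed.

End DiscreteElements.

(** * Families with the same joint law *)

Section JointLaw.
Context (d : measure_display) (T : measurableType d) (R : realType).
Context (P : probability T R).

(** Equality on boxes only: boxes form a pi-system generating the product
    sigma-algebra, so this is equality of the joint laws, and boxes are all that
    independence and marginals refer to. *)
Definition same_joint_law (K : finType) (X Y : K -> {RV P >-> R}) : Prop :=
  forall B : K -> set R, (forall i, measurable (B i)) ->
    P (\bigcap_i (X i @^-1` B i)) = P (\bigcap_i (Y i @^-1` B i)).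

Lemma same_joint_law_bigcap (K : finType) (X Y : K -> {RV P >-> R})
    (S : {set K}) (A : K -> set R) :
  same_joint_law X Y -> (forall i, measurable (A i)) ->
  P (\bigcap_(i in [set` S]) (X i @^-1` A i)) =
  P (\bigcap_(i in [set` S]) (Y i @^-1` A i)).
Proof.
move=> XY mA.
(* A constraint on the coordinates in S alone is a box with full sides
   elsewhere. *)
pose B i := if i \in [set` S] then A i else setT.
have BE (W : K -> {RV P >-> R}) :
    \bigcap_(i in [set` S]) (W i @^-1` A i) = \bigcap_i (W i @^-1` B i).
  rewrite bigcap_mkcond; apply: eq_bigcapr => i _.
  by rewrite /B; case: ifP.
by rewrite !BE XY // => i; rewrite /B; case: ifP.
Qed.

Lemma same_joint_law_marginal (K : finType) (X Y : K -> {RV P >-> R}) (i : K)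
    (A : set R) :
  same_joint_law X Y -> measurable A -> P (X i @^-1` A) = P (Y i @^-1` A).
Proof.
move=> XY mA; have := same_joint_law_bigcap [set i]%SET XY (fun=> mA).
have -> : [set` [set i]%SET] = [set i].
  by apply/seteqP; split=> j /=; rewrite inE => /eqP.
by rewrite !bigcap_set1.
Qed.

Lemma same_joint_law_independent (K : finType) (X Y : K -> {RV P >-> R}) :
  same_joint_law X Y -> mutually_independent X -> mutually_independent Y.
Proof.
move=> XY iX S A mA; rewrite -(same_joint_law_bigcap S XY mA) iX //.
by apply: eq_bigr => i _; exact: same_joint_law_marginal.
Qed.

Lemma bigcap_triple (X Y Z : {RV P >-> R}) (A : 'I_3 -> set R) :
  \bigcap_i (tnth [tuple X; Y; Z] i @^-1` A i) =
  (fun x => (X x, Y x, Z x)) @^-1` (A 0 `*` A 1 `*` A 2%:R).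
Proof.
apply/seteqP; split=> x /=.
  by move=> h; split; [split|]; [exact: (h 0)|exact: (h 1)|exact: (h 2%:R)].
move=> [[h0 h1] h2] i _; case: i => [[|[|[|//]]] i3] /=.
- by rewrite (_ : Ordinal i3 = 0) //; exact: val_inj.
- by rewrite (_ : Ordinal i3 = 1) //; exact: val_inj.
- by rewrite (_ : Ordinal i3 = 2%:R) //; exact: val_inj.
Qed.

Lemma independent_triple (X Y Z : {RV P >-> R}) (A B C : set R) :
  mutually_independent (tnth [tuple X; Y; Z]) ->
  measurable A -> measurable B -> measurable C ->
  P ((fun x => (X x, Y x, Z x)) @^-1` (A `*` B `*` C)) =
  (P (X @^-1` A) * P (Y @^-1` B) * P (Z @^-1` C))%E.
Proof.
move=> iXYZ mA mB mC.
pose D (i : 'I_3) := tnth [tuple A; B; C] i.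
have mD i : measurable (D i) by case: i => [[|[|[|//]]] i3].
have := iXYZ [set: 'I_3]%SET D mD.
have -> : [set` [set: 'I_3]%SET] = setT.
  by apply/seteqP; split=> // i _ /=; rewrite inE.
rewrite bigcap_triple => ->.
rewrite (eq_bigl xpredT) => [|i]; last by rewrite inE.
by rewrite !big_ord_recr big_ord0 /= mul1e.
Qed.

Lemma measurable_triple_box (X Y Z : {RV P >-> R}) (A B C : set R) :
  measurable A -> measurable B -> measurable C ->
  measurable ((fun x => (X x, Y x, Z x)) @^-1` (A `*` B `*` C)).
Proof.
move=> mA mB mC.
have -> : (fun x => (X x, Y x, Z x)) @^-1` (A `*` B `*` C) =
  X @^-1` A `&` Y @^-1` B `&` Z @^-1` C by [].
by do 2?apply: measurableI; exact: measurable_funPTI.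
Qed.

End JointLaw.

(** * The involution on the state space *)

(** [burke_map] in the coordinates (I, J, omega) of the state space, tabulated
    so that it is visibly an involution. *)
Definition burke_step (s : bool * nat * bool) : bool * nat * bool :=
  match s with
  | (false, l, false) => (false, l, false)
  | (false, l, true) => (true, l.+1, false)
  | (true, 0%N, false) => (true, 0%N, false)
  | (true, l.+1, false) => (false, l, true)
  | (true, l, true) => (true, l, true)
  end.

Lemma burke_stepK : involutive burke_step.
Proof. by move=> [[[] [|l]] []]. Qed.

Section Burke.
Context (R : realType).

Definition state_embed (s : bool * nat * bool) : R * R * R :=
  (s.1.1%:R, s.1.2%:R, s.2%:R).

Lemma state_embed_inj : injective state_embed.
Proof.
move=> [[b l] c] [[b' l'] c'] [] /eqP + /eqP + /eqP.
by rewrite !eqr_nat => + /eqP <-; case: b b' c c' => [] [] [] [].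
Qed.

Lemma set1_state_embed s :
  [set state_embed s] = [set s.1.1%:R] `*` [set s.1.2%:R] `*` [set s.2%:R].
Proof.
by case: s => [[b l] c]; apply/seteqP; split=> [_ ->|[[? ?] ?] [[/= -> ->] ->]].
Qed.

Definition burke_map (z : R * R * R) : R * R * R :=
  let: (i, j, w) := z in
  (Num.max (i - j) w, Num.max (j - i + w) 0, Num.min i (j + w)).

Lemma burke_map_embed s :
  burke_map (state_embed s) = state_embed (burke_step s).
Proof.
case: s => [[i l] c]; rewrite /burke_map /state_embed.
(* In both cases l = 0 and l = l'.+1 this bounds the variable left after the
   case analysis. *)
have := ler0n R l.-1; case: i c l => [] [] [|l] /= l0;
  rewrite -?[l.+1%:R]natr1 ?maxEle ?minEle.
all: by congr (_, _, _); case: ifP; lra.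
Qed.

Definition burke_weight (p u : R) (s : bool * nat * bool) : R :=
  bernoulli_pmf u s.1.1 *
  geometric_pmf ((u - p) / (u * (1 - p))) s.1.2 * bernoulli_pmf p s.2.

(** Detailed balance between (0, l, 1) and (1, l+1, 0).  After the common powers
    are cancelled it reads (1-u) p = u (1-q) (1-p), which is the formula for
    1 - q. *)
Lemma burke_weight_step (p u : R) (s : bool * nat * bool) :
  0 < p < 1 -> p < u ->
  burke_weight p u (burke_step s) = burke_weight p u s.
Proof.
move=> /andP[p0 p1] pu.
have u0 : u != 0 by rewrite gt_eqF // (lt_trans p0).
have q0 : 1 - p != 0 by rewrite subr_eq0 gt_eqF.
by case: s => [[[] [|l]] []];
  rewrite /burke_weight /bernoulli_pmf /geometric_pmf //= exprS; field;
  rewrite u0 q0.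
Qed.

(** * Masses of points *)

Lemma Ber_set1 (q : R) (b : bool) : 0 <= q <= 1 ->
  Ber q [set b%:R] = (bernoulli_pmf q b)%:E.
Proof.
move=> q01; rewrite /Ber /pushforward /bernoulli_prob q01.
have -> : (fun c : bool => c%:R : R) @^-1` [set b%:R] = [set b].
  apply/seteqP; split=> [c /= /eqP|c /= -> //].
  by rewrite eqr_nat; case: b c => [] [].
by rewrite fsbig_set1.
Qed.

Lemma Geom_set1 (q : R) (l : nat) : 0 <= q <= 1 ->
  Geom q [set l%:R] = (geometric_pmf q l)%:E.
Proof.
move=> /andP[q0 q1]; rewrite /Geom /pushforward /geometric_prob.
have -> : (fun k : nat => k%:R : R) @^-1` [set l%:R] = [set l].
  by apply/seteqP; split=> [k /= /eqP|k /= -> //]; rewrite eqr_nat => /eqP.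
by rewrite esum_set1 // lee_fin mulr_ge0 // exprn_ge0 // subr_ge0.
Qed.

Lemma measurable_range_countable (S : countType) (f : S -> R) :
  measurable (range f).
Proof.
apply: countable_measurable => //.
exact: (sub_countable (card_image_le _ _)).
Qed.

(** * The joint law is preserved *)

Section Joint.
Context (d : measure_display) (T : measurableType d) (P : probability T R).
Context (p u : R) (I J omega : {RV P >-> R}).
Context (hp : 0 < p < 1) (hu : p < u <= 1).
Context (hindep : mutually_independent (tnth [tuple I; J; omega])).
Context (hI : has_law I (Ber u)).
Context (hJ : has_law J (Geom ((u - p) / (u * (1 - p))))).
Context (homega : has_law omega (Ber p)).

Let Z x := (I x, J x, omega x).

Lemma burke_joint_pmf s :
  P (Z @^-1` [set state_embed s]) = (burke_weight p u s)%:E.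
Proof.
have /andP[p0 p1] := hp; have /andP[pu u1] := hu.
rewrite set1_state_embed independent_triple //.
have hX (X : {RV P >-> R}) nu a :
    has_law X nu -> P (X @^-1` [set a]) = nu [set a].
  by move=> hX; exact: hX.
rewrite (hX _ _ _ hI) (hX _ _ _ hJ) (hX _ _ _ homega).
have u0 : 0 < u by apply: lt_trans pu.
rewrite !Ber_set1 ?Geom_set1 ?(ltW p0) ?(ltW p1) ?(ltW u0) //.
have m0 : 0 < u * (1 - p) by rewrite mulr_gt0 // subr_gt0.
(* The parameter of the geometric law is at most 1: this is p (1 - u) >= 0. *)
by rewrite ler_pdivrMr // divr_ge0 ?(ltW m0) ?subr_ge0 ?(ltW pu) //=; nra.
Qed.

Lemma burke_joint_support : P (Z @^-1` range (@state_embed)) = 1%E.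
Proof.
have -> : range (@state_embed) = range (fun b : bool => b%:R) `*`
    range (fun l : nat => l%:R) `*` range (fun b : bool => b%:R).
  apply/seteqP; split=> [_ [[[b l] c] _ <-]|[[? ?] ?]].
    by split; [split; [exists b|exists l]|exists c].
  by move=> [[[b _ /= <-] [l _ /= <-]] [c _ /= <-]]; exists (b, l, c).
rewrite independent_triple //; [|exact: measurable_range_countable..].
rewrite (has_law_range _ hI) ?(has_law_range _ hJ) ?(has_law_range _ homega)
  ?mule1 //; exact: measurable_range_countable.
Qed.

Lemma burke_same_joint_law :
  same_joint_law (tnth [tuple I; J; omega])
    (tnth [tuple burke_I I J omega; burke_J I J omega; burke_alpha I J omega]).
Proof.
move=> A mA.
have /andP[pu _] := hu.
rewrite !bigcap_triple; apply/esym.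
apply: (probability_discrete_symmetry (b := burke_map) state_embed_inj _
  burke_joint_support burke_stepK burke_map_embed).
- move=> s; rewrite set1_state_embed.
  exact: measurable_triple_box.
- by move=> s; rewrite !burke_joint_pmf burke_weight_step.
- exact: measurable_triple_box.
- exact: (measurable_triple_box (burke_I I J omega) (burke_J I J omega)
    (burke_alpha I J omega)).
Qed.

End Joint.

End Burke.

(** * Burke's property *)

Theorem lemma2p4 (R : realType) (d : measure_display) (T : measurableType d)
    (P : probability T R) (p u : R) (I J omega : {RV P >-> R})
    (hp : 0 < p < 1) (hu : p < u <= 1)
    (hindep : mutually_independent (tnth [tuple I; J; omega]))
    (hI : has_law I (Ber u))
    (hJ : has_law J (Geom ((u - p) / (u * (1 - p)))))
    (homega : has_law omega (Ber p)) :
  mutually_independent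
    (tnth [tuple burke_I I J omega; burke_J I J omega;
                 burke_alpha I J omega]) /\
  has_law (burke_I I J omega) (Ber u) /\
  has_law (burke_J I J omega) (Geom ((u - p) / (u * (1 - p)))) /\
  has_law (burke_alpha I J omega) (Ber p).
Proof.
have joint := burke_same_joint_law hp hu hindep hI hJ homega.
split; first exact: same_joint_law_independent joint hindep.
split=> [A mA|]; last split=> [A mA|A mA].
- by rewrite -hI //; exact/esym/(same_joint_law_marginal 0 joint mA).
- by rewrite -hJ //; exact/esym/(same_joint_law_marginal 1 joint mA).
- by rewrite -homega //; exact/esym/(same_joint_law_marginal 2%:R joint mA).
Qed.
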